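(* Let $\varphi\in L^2(\mathbb{R}^2)$ satisfy $\operatorname{supp}(\varphi)\subseteq[N_1,M_1]\times[N_2,M_2]$, suppose that $\{\varphi(\cdot-\boldsymbol{k}):\boldsymbol{k}\in\mathbb{Z}^2\}$ is linearly independent, and assume: (i) the Sobolev smoothness satisfies $\nu_2(\varphi)>1/2$; (ii) $\widehat{\varphi}(\boldsymbol{0})=\int_{\mathbb{R}^2}\varphi(\boldsymbol{x})\,d\boldsymbol{x}=0$. Let $f\in V(\varphi,\mathbb{Z}^2)$ be an arbitrary target function with $\operatorname{supp}(f)\subseteq[a_1,b_1]\times[a_2,b_2]$. Let $$E=\big([\lceil a_1-M_1\rceil,\lfloor b_1-N_1\rfloor]\times[\lceil a_2-M_2\rceil,\lfloor b_2-N_2\rfloor]\big)\cap\mathbb{Z}^2,$$ and let $E^+=\emptyset$ if $\#E=1$ and $E^+=\{\boldsymbol{x}-\boldsymbol{y}:\boldsymbol{x}\neq\boldsymbol{y}\in E\}$ if $\#E>1$. Then for any direction vector $\boldsymbol{p}\in\mathrm{DV}_{\widehat{\varphi}}\setminus\mathrm{dv}_{\mathcal{N}_{E^+}}$ there exists a sampling set $X_{\boldsymbol{p}}\subseteq\mathbb{R}$ with $\#X_{\boldsymbol{p}}=\#E$ such that $f$ can be determined uniquely by its single-angle Radon samples (with respect to $\boldsymbol{p}$) at $X_{\boldsymbol{p}}$.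
   Context: Vectors in $\mathbb{R}^2$ are columns; a direction vector $\boldsymbol{p}=(\cos\theta,\sin\theta)$ is a row vector. $\mathcal{R}_{\boldsymbol{p}}f(t)=\int_{-\infty}^{\infty}f(t\cos\theta-s\sin\theta,\,t\sin\theta+s\cos\theta)\,ds$. The Fourier transform is $\widehat{g}(\gamma)=\int_{\mathbb{R}^d}g(\boldsymbol{x})e^{-i\boldsymbol{x}\cdot\gamma}d\boldsymbol{x}$. $H^\varsigma(\mathbb{R}^d)=\{g:\int_{\mathbb{R}^d}|\widehat g(\xi)|^2(1+\|\xi\|_2^2)^{\varsigma}d\xi<\infty\}$ and $\nu_2(g)=\sup\{\varsigma:g\in H^\varsigma(\mathbb{R}^d)\}$. $V(\varphi,\mathbb{Z}^2)=\{\sum_{\boldsymbol{k}\in\mathbb{Z}^2}c_{\boldsymbol{k}}\varphi(\cdot-\boldsymbol{k}):\sum_{\boldsymbol{k}}|c_{\boldsymbol{k}}|^2<\infty\}$. For $\mathcal{S}\subseteq\mathbb{R}^2$ with $\mathcal{S}\setminus\{\boldsymbol{0}\}\ne\emptyset$: the direction vector set is $\mathrm{dv}_{\mathcal{S}}=\{(\cos\theta,\sin\theta):\ \boldsymbol{0}\neq\boldsymbol{x}=\|\boldsymbol{x}\|_2(\cos\theta,\sin\theta)^T\in\mathcal{S}\}$, and the null set is $\mathcal{N}_{\mathcal{S}}=\{\boldsymbol{0}\ne\boldsymbol{y}\in\mathbb{R}^2:\text{there is }\boldsymbol{0}\neq\boldsymbol{x}\in\mathcal{S}\text{ with }\boldsymbol{x}^T\boldsymbol{y}=0\}$.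 For $\mathcal{S}=\emptyset$ or $\{\boldsymbol{0}\}$, both sets are defined to be $\emptyset$. Let $\mathring{\mathcal{D}}(\boldsymbol{x}_0,\delta)=\{\boldsymbol{x}\in\mathbb{R}^2:\|\boldsymbol{x}-\boldsymbol{x}_0\|_2<\delta\}$. Let $\mathcal{G}_{\widehat{\varphi}}=\{\boldsymbol{x}\in\mathbb{R}^2:\widehat{\varphi}(\boldsymbol{x})\ne0\}$, and for $\boldsymbol{x}\in\mathcal{G}_{\widehat{\varphi}}$ let $\delta^{\widehat{\varphi}}_{\boldsymbol{x},\max}\in(0,\infty]$ be the maximum value such that $\widehat{\varphi}$ has no zero in $\mathring{\mathcal{D}}(\boldsymbol{x},\delta^{\widehat{\varphi}}_{\boldsymbol{x},\max})$. Then $\mathrm{DV}_{\widehat{\varphi}}=\bigcup_{\boldsymbol{x}\in\mathcal{G}_{\widehat{\varphi}}}\mathrm{dv}_{\mathring{\mathcal{D}}(\boldsymbol{x},\delta^{\widehat{\varphi}}_{\boldsymbol{x},\max})}$. Standing convention: a target function $f\in V(\varphi,\mathbb{Z}^2)$ with $\operatorname{supp}(f)\subseteq[a_1,b_1]\times[a_2,b_2]$ is one expressed as $f=\sum_{\boldsymbol{k}\in E}c_{\boldsymbol{k}}\varphi(\cdot-\boldsymbol{k})$ with $c_{\boldsymbol{k}}\in\mathbb{C}$. ''$f$ can be determined uniquely by its single-angle Radon samples at $X$'' means that $f$ is the only function $h$ of the form $\sum_{\boldsymbol{k}\in E}d_{\boldsymbol{k}}\varphi(\cdot-\boldsymbol{k})$,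 $d_{\boldsymbol{k}}\in\mathbb{C}$, with $\mathcal{R}_{\boldsymbol{p}}h(x)=\mathcal{R}_{\boldsymbol{p}}f(x)$ for all $x\in X$. The set $X_{\boldsymbol{p}}$ depends on $\varphi,E,\boldsymbol{p}$ but not on $f$. $\mathcal{R}_{\boldsymbol{p}}\varphi$ agrees almost everywhere with a continuous function under hypothesis (i), and samples are values of the continuous representative. *)

(* Defs.v *)
From HB Require Import structures.
From mathcomp Require Import all_boot all_order all_algebra.
From mathcomp Require Import all_classical all_reals all_analysis.
From mathcomp Require Import complex.
Set Implicit Arguments.
Unset Strict Implicit.
Unset Printing Implicit Defensive.
Import Order.TTheory GRing.Theory Num.Theory.
Import numFieldNormedType.Exports.
Local Open Scope classical_set_scope.
Local Open Scope ring_scope.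

(* Complex-valued functions are plain functions into R[i].  The library has no
   measurable structure or integral for R[i], so measurability and integrals
   are taken componentwise.  Equality of L^2 functions on the plane is equality
   almost everywhere, and supports are essential supports. *)

Definition plane (R : realType) : Type :=
  (measurableTypeR R * measurableTypeR R)%type.

Definition leb1 (R : realType) : {measure set (measurableTypeR R) -> \bar R} :=
  @lebesgue_measure R.

Definition leb2 (R : realType) :
    {measure set (measurableTypeR R * measurableTypeR R) -> \bar R} :=
  (@lebesgue_measure R \x @lebesgue_measure R)%E.

Section ComplexIntegration.
Context {R : realType} {d : measure_display} {T : measurableType d}.
Variable mu : {measure set T -> \bar R}.

Definition cmeasurable (f : T -> R[i]) : Prop :=
  measurable_fun setT (fun x => complex.Re (f x)) /\
  measurable_fun setT (fun x => complex.Im (f x)).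

Definition cintegral (f : T -> R[i]) : R[i] :=
  (Rintegral mu setT (fun x => complex.Re (f x)) +i*
   Rintegral mu setT (fun x => complex.Im (f x)))%C.

(* the square of the L^2 norm *)
Definition sqnormL2 (f : T -> R[i]) : \bar R :=
  (\int[mu]_x ((Normc.normc (f x)) ^+ 2)%:E)%E.

Definition squareIntegrable (f : T -> R[i]) : Prop :=
  cmeasurable f /\ (sqnormL2 f < +oo)%E.

End ComplexIntegration.

Section Plane.
Context {R : realType}.
Implicit Types (f g phi : plane R -> R[i]) (x y p : plane R).

Definition dot x y : R := x.1 * y.1 + x.2 * y.2.

(* The norm that the library puts on a product is the max norm. *)
Definition norm2 x : R := Num.sqrt (x.1 ^+ 2 + x.2 ^+ 2).

Definition rect (a1 b1 a2 b2 : R) : set (plane R) :=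
  [set x | a1 <= x.1 <= b1 /\ a2 <= x.2 <= b2].

Definition supported_in (A : set (plane R)) f : Prop :=
  {ae leb2 R, forall x, ~ A x -> f x = 0}.

(* \int f(x) e^{-i x.xi} dx; this is the Fourier transform of f for integrable
   f, in particular for compactly supported f in L^2. *)
Definition fourier f (xi : plane R) : R[i] :=
  cintegral (leb2 R) (fun x => f x * (cos (dot x xi) -i* sin (dot x xi))%C).

Definition in_sobolev (s : R) f : Prop :=
  (\int[leb2 R]_xi
     (Normc.normc (fourier f xi) ^+ 2 * (1 + norm2 xi ^+ 2) `^ s)%:E < +oo)%E.

Definition sobolev_exponent f : \bar R :=
  ereal_sup [set s%:E | s in [set s : R | in_sobolev s f]].

Definition radon p f (t : R) : R[i] :=
  cintegral (leb1 R)
    (fun s : measurableTypeR R =>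
       f (t * p.1 - s * p.2, t * p.2 + s * p.1)).

(* The sample of the Radon transform at t is the value at t of the continuous
   function that agrees with it almost everywhere (there is at most one); when
   there is none, it is the value of the integral itself. *)
Definition radon_sample p f : R -> R[i] :=
  xget (radon p f)
    [set g : R -> R[i] | continuous (g : R -> R[i]^o) /\
       {ae leb1 R, forall t, radon p f t = g t}].

Definition translate (k : int * int) f : plane R -> R[i] :=
  fun x => f (x.1 - k.1%:~R, x.2 - k.2%:~R).

(* Used for finite F only: \sum_(k \in F) is 0 when infinitely many terms of
   the family over F are nonzero. *)
Definition shift_comb (F : set (int * int)) (c : int * int -> R[i]) phi :
    plane R -> R[i] :=
  fun x => \sum_(k \in F) c k * translate k phi x.

Definition shifts_independent phi : Prop :=
  forall (F : set (int * int)) (c : int * int -> R[i]), finite_set F ->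
    {ae leb2 R, forall x, shift_comb F c phi x = 0} ->
    forall k, F k -> c k = 0.

(* The series converges unconditionally in L^2. *)
Definition shift_space phi : set (plane R -> R[i]) :=
  [set f | cmeasurable f /\ exists c : int * int -> R[i],
    (\esum_(k in [set: int * int]) ((Normc.normc (c k)) ^+ 2)%:E < +oo)%E /\
    forall e : R, 0 < e -> exists2 F0 : set (int * int), finite_set F0 &
      forall F : set (int * int), finite_set F -> F0 `<=` F ->
        (sqnormL2 (leb2 R) (fun x => f x - shift_comb F c phi x)%R < e%:E)%E].

Definition dv (S : set (plane R)) : set (plane R) :=
  [set p | exists x (theta : R), [/\ S x, x <> (0, 0),
     x = (norm2 x * cos theta, norm2 x * sin theta) &
     p = (cos theta, sin theta)]].

Definition orth_null_set (S : set (plane R)) : set (plane R) :=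
  [set y | y <> (0, 0) /\ exists x, [/\ S x, x <> (0, 0) & dot x y = 0]].

Definition open_disc (x0 : plane R) (delta : \bar R) : set (plane R) :=
  [set x | ((norm2 (x.1 - x0.1, x.2 - x0.2))%:E < delta)%E].

Definition nonzero_set (F : plane R -> R[i]) : set (plane R) :=
  [set x | F x <> 0].

(* The supremum is attained, since the discs are open. *)
Definition delta_max (F : plane R -> R[i]) (x : plane R) : \bar R :=
  ereal_sup [set delta : \bar R | (0 < delta)%E /\
    forall y, open_disc x delta y -> F y <> 0].

Definition DV (F : plane R -> R[i]) : set (plane R) :=
  \bigcup_(x in nonzero_set F) dv (open_disc x (delta_max F x)).

Definition index_set (N1 M1 N2 M2 a1 b1 a2 b2 : R) : set (int * int) :=
  [set k | Num.ceil (a1 - M1) <= k.1 <= Num.floor (b1 - N1) /\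
           Num.ceil (a2 - M2) <= k.2 <= Num.floor (b2 - N2)].

(* empty when E has at most one element *)
Definition differences (E : set (int * int)) : set (plane R) :=
  [set z | exists k l, [/\ E k, E l, k <> l &
     z = ((k.1 - l.1)%:~R, (k.2 - l.2)%:~R)]].

Definition expressed_on (E : set (int * int)) phi f : Prop :=
  exists c : int * int -> R[i], f = shift_comb E c phi.

(* The representation over E is part of what is meant by a target function
   supported in the rectangle. *)
Definition target_function (N1 M1 N2 M2 a1 b1 a2 b2 : R) phi f : Prop :=
  [/\ shift_space phi f, supported_in (rect a1 b1 a2 b2) f &
      expressed_on (index_set N1 M1 N2 M2 a1 b1 a2 b2) phi f].

Definition determined_by_radon_samples (E : set (int * int)) phi p (X : set R)
    f : Prop :=
  forall h, expressed_on E phi h ->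
    (forall t, X t -> radon_sample p h t = radon_sample p f t) -> h = f.

End Plane.

(* Main.v *)
(* Write g for the Radon transform of phi in the direction p.  The transform of
   a translate of phi by k is the translate of g by tau_k = p.k, and the tau_k
   are distinct for k in E because p is orthogonal to no difference of two
   points of E.  By the Fourier slice identity g does not vanish almost
   everywhere, and it has bounded support, so its translates by the tau_k are
   linearly independent: in sum_k c_k g(t - tau_k) = h(t), solve for the term
   with the least tau_k among those with c_k <> 0; this expresses g(t) by h and
   by values of g at distance at least a fixed gap to the left of t, and
   iterating from the left of the support gives g = 0 when h = 0.  Independent
   functions on a set can be separated by as many points of the set as there
   are functions, and these points are the sampling set.

   The same recursion shows that if a nontrivial combination h agrees almost
   everywhere with a continuous function, then so does g.  Hence either g has a continuous
   representative, and so have all combinations, or no nontrivial combination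
   has one; in both cases the samples of all combinations are given by the
   same linear formula outside a null set not depending on the coefficients. *)

Require Import Defs.
From mathcomp Require Import all_boot all_order all_algebra finmap.
From mathcomp Require Import all_classical all_reals all_analysis.
From mathcomp Require Import measurable_realfun.
From mathcomp Require Import complex ring lra zify.
Set Implicit Arguments.
Unset Strict Implicit.
Unset Printing Implicit Defensive.
Import Order.TTheory GRing.Theory Num.Theory.
Import numFieldNormedType.Exports.
Local Open Scope classical_set_scope.
Local Open Scope ring_scope.

(** * Integration under measure-preserving self-maps *)

Section MeasurePreserving.
Context {d} {T : measurableType d} {R : realType}.
Variable mu : {measure set T -> \bar R}.

Definition measure_preserving (h : T -> T) : Prop :=
  measurable_fun setT h /\
  forall A, measurable A -> mu (h @^-1` A) = mu A.

Lemma measure_preserving_id : measure_preserving id.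
Proof. by split. Qed.

Lemma measure_preserving_comp g h :
  measure_preserving g -> measure_preserving h -> measure_preserving (g \o h).
Proof.
move=> [mg pg] [mh ph]; split; first exact: measurableT_comp.
move=> A mA; rewrite comp_preimage ph ?pg//.
by rewrite -[X in measurable X]setTI; exact: mg.
Qed.

Lemma measure_preserving_ae h (P : T -> Prop) : measure_preserving h ->
  {ae mu, forall x, P x} -> {ae mu, forall x, P (h x)}.
Proof.
move=> [mh ph] [N [mN N0 PN]]; exists (h @^-1` N); split.
- by rewrite -[X in measurable X]setTI; exact: mh.
- by rewrite ph.
- by move=> x /= nP; exact: PN.
Qed.

Lemma measure_preserving_integrable h (f : T -> \bar R) :
  measure_preserving h -> mu.-integrable setT f ->
  mu.-integrable setT (f \o h).
Proof.
move=> [mh ph] /integrableP[mf foo]; apply/integrableP; split.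
  exact: measurableT_comp.
apply: le_lt_trans foo; rewrite le_eqVlt; apply/orP; left; apply/eqP.
rewrite -[LHS](@ge0_integral_pushforward _ _ _ _ _ _ mh mu setT (abse \o f))//.
- by apply: eq_measure_integral => A mA _; rewrite -[RHS]ph.
- exact: measurableT_comp.
- by move=> y _; exact: abse_ge0.
Qed.

Lemma measure_preserving_integral h (f : T -> \bar R) :
  measure_preserving h -> mu.-integrable setT f ->
  (\int[mu]_x f (h x) = \int[mu]_x f x)%E.
Proof.
move=> hP fi; have [mh ph] := hP; have [mf _] := integrableP _ _ _ fi.
have := integral_pushforward mh mf (measure_preserving_integrable hP fi)
  measurableT.
rewrite preimage_setT => <-; apply: eq_measure_integral => A mA _.
by rewrite -[RHS]ph.
Qed.

End MeasurePreserving.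

(** * Translations of the line; shears and rotations of the plane *)

Section PlaneMaps.
Context {R : realType}.
Local Notation mu := (@lebesgue_measure R).

(** Lebesgue measure is determined by its values on half-open intervals, and the pushforward takes
    the same values there. *)
Lemma preserving_translation (a : R) :
  measure_preserving (leb1 R) (fun x => x - a).
Proof.
pose tr : measurableTypeR R -> measurableTypeR R := fun x => x - a.
have mt : measurable_fun setT tr.
  by apply: measurable_funB => //; exact: measurable_cst.
split=> //= A mA; rewrite /leb1/=.
apply/esym; apply: (@lebesgue_measure_unique _ (pushforward mu tr)) => //=.
move=> _ [[b c]] _ <-.
rewrite /pushforward (_ : _ @^-1` _ = `]b + a, c + a]%classic); last first.
  by apply/seteqP; split=> x /=; rewrite !in_itv/= ltrBrDr lerBlDr.
rewrite !lebesgue_measure_itv/= !lte_fin ltrD2r -!EFinB.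
by case: ifP => // _; congr EFin; ring.
Qed.

(** Vertical sections of the preimage are translates of those of the set, so integrating section
    measures reduces this to translation invariance. *)
Lemma preserving_shear (a : R) :
  measure_preserving (leb2 R) (fun x => (x.1, x.2 + a * x.1)).
Proof.
have m1 : measurable_fun setT (fst : plane R -> measurableTypeR R).
  exact: measurable_fst.
have m2 : measurable_fun setT (snd : plane R -> measurableTypeR R).
  exact: measurable_snd.
have mh : measurable_fun setT
    ((fun x => (x.1, x.2 + a * x.1)) : plane R -> plane R).
  apply: measurable_fun_pair => //; apply: measurable_funD => //.
  by apply: measurable_funM => //; exact: measurable_cst.
split=> // A mA; rewrite /leb2/= /product_measure1.
apply: eq_integral => x _ /=.
have [_ /(_ (xsection A x))] := preserving_translation (- (a * x)).
rewrite /leb1/= => <-; last exact: measurable_xsection.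
congr (mu _); apply/seteqP; split=> y; rewrite /xsection /= !inE /= opprK //.
Qed.

Lemma preserving_swap : measure_preserving (leb2 R) (fun x => (x.2, x.1)).
Proof.
have mh : measurable_fun setT ((fun x => (x.2, x.1)) : plane R -> plane R).
  exact: measurable_fun_pair.
split=> // A mA; rewrite /leb2/=.
apply/esym.
apply: (@product_measure_unique _ _ _ _ R mu mu
  (pushforward (leb2 R) ((fun x => (x.2, x.1)) : plane R -> plane R))) => //.
move=> B C mB mC; rewrite /pushforward.
transitivity (leb2 R (C `*` B)); last first.
  by rewrite /leb2/= product_measure1E// muleC.
by congr (leb2 R _); apply/seteqP; split=> -[x y] [].
Qed.

Definition rotate (p x : plane R) : plane R :=
  (x.1 * p.1 - x.2 * p.2, x.1 * p.2 + x.2 * p.1).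

(* A rotation with nonzero sine s and cosine c is a product of three shears,
   with slopes (c - 1) / s, s and (c - 1) / s; the half turn is the square of a
   quarter turn. *)
Lemma preserving_rotation p : dot p p = 1 ->
  measure_preserving (leb2 R) (rotate p).
Proof.
have nonaxial q : q.2 != 0 -> dot q q = 1 ->
    measure_preserving (leb2 R) (rotate q).
  case: q => c s /= s0; rewrite /dot/= => cs1.
  have [a aE] : exists a, a * s = c - 1 by exists ((c - 1) / s); rewrite divfK.
  have cE : c = 1 + a * s by rewrite aE; ring.
  (* [a] is minus the tangent of the half angle; this identity turns the entry [a * (2 + a * s)] of
     the product of shears into [- s]. *)
  have as0 : a * (1 + c) = - s.
    have cc : c * c = 1 - s * s by rewrite -cs1; ring.
    by apply: (mulIf s0); rewrite mulrAC aE; ring: cc.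
  have pu : measure_preserving (leb2 R) (fun x => (x.1 + a * x.2, x.2)).
    rewrite (_ : (fun _ => _) =
      (fun x : plane R => (x.2, x.1)) \o (fun x => (x.1, x.2 + a * x.1))
        \o (fun x => (x.2, x.1)))//.
    apply: measure_preserving_comp; last exact: preserving_swap.
    apply: measure_preserving_comp; first exact: preserving_swap.
    exact: preserving_shear.
  rewrite (_ : rotate _ =
    (fun x : plane R => (x.1 + a * x.2, x.2)) \o (fun x => (x.1, x.2 + s * x.1))
        \o (fun x => (x.1 + a * x.2, x.2))).
    apply: measure_preserving_comp => //.
    apply: measure_preserving_comp => //; exact: preserving_shear.
  apply/funext => -[x y]; rewrite /rotate /=; congr (_, _).
    by rewrite -mulrN -as0 cE; ring.
  by rewrite cE; ring.
case: p => c s; have [->|s0] := eqVneq s 0; last exact: nonaxial.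
rewrite /dot/= mulr0 addr0 => c1.
have : (c - 1) * (c + 1) = 0.
  by transitivity (c * c - 1); [ring|rewrite c1 subrr].
move=> /eqP; rewrite mulf_eq0 subr_eq0 addr_eq0 => /orP[|] /eqP ->.
  rewrite (_ : rotate _ = id); first exact: measure_preserving_id.
  by apply/funext => -[x y]; rewrite /rotate/=; congr (_, _); ring.
rewrite (_ : rotate _ = rotate (0, 1) \o rotate (0, 1)).
  by apply: measure_preserving_comp; apply: nonaxial => //=;
    rewrite ?oner_eq0// /dot/=; ring.
by apply/funext => -[x y]; rewrite /rotate/=; congr (_, _); ring.
Qed.

End PlaneMaps.

(** * Componentwise integration of complex functions *)

Section ComplexIntegral.
Context {d} {T : measurableType d} {R : realType}.
Variable mu : {measure set T -> \bar R}.
Implicit Types (f g : T -> R[i]) (z : R[i]).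

Definition cintegrable f : Prop :=
  mu.-integrable setT (fun x => (complex.Re (f x))%:E) /\
  mu.-integrable setT (fun x => (complex.Im (f x))%:E).

Lemma ReM (z w : R[i]) :
  complex.Re (z * w) =
  complex.Re z * complex.Re w - complex.Im z * complex.Im w.
Proof. by case: z; case: w. Qed.

Lemma ImM (z w : R[i]) :
  complex.Im (z * w) =
  complex.Re z * complex.Im w + complex.Im z * complex.Re w.
Proof. by case: z; case: w. Qed.

Lemma ReD (z w : R[i]) : complex.Re (z + w) = complex.Re z + complex.Re w.
Proof. by case: z; case: w. Qed.

Lemma ImD (z w : R[i]) : complex.Im (z + w) = complex.Im z + complex.Im w.
Proof. by case: z; case: w. Qed.

Lemma cintegrable0 : cintegrable (fun=> 0).
Proof. by split; exact: integrable0. Qed.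

Lemma cintegrableD f g :
  cintegrable f -> cintegrable g -> cintegrable (fun x => f x + g x).
Proof.
move=> [fr fi] [gr gi]; split.
  under eq_fun do rewrite ReD EFinD; exact: integrableD.
under eq_fun do rewrite ImD EFinD; exact: integrableD.
Qed.

Lemma cintegrableZ z f : cintegrable f -> cintegrable (fun x => z * f x).
Proof.
move=> [fr fi]; split.
  under eq_fun do rewrite ReM EFinB !EFinM.
  by apply: integrableB => //; exact: integrableZl.
under eq_fun do rewrite ImM EFinD !EFinM.
by apply: integrableD => //; exact: integrableZl.
Qed.

Lemma cintegral0 : cintegral mu (fun=> 0) = 0.
Proof. by rewrite /cintegral /= Rintegral_cst// mul0r. Qed.

Lemma cintegralD f g : cintegrable f -> cintegrable g ->
  cintegral mu (fun x => f x + g x) = cintegral mu f + cintegral mu g.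
Proof.
move=> [fr fi] [gr gi]; apply/eqP; rewrite eq_complex /=.
rewrite -!RintegralD//.
apply/andP; split; apply/eqP; apply: eq_Rintegral => x _.
  exact: ReD.
exact: ImD.
Qed.

Lemma cintegralZ z f : cintegrable f ->
  cintegral mu (fun x => z * f x) = z * cintegral mu f.
Proof.
move=> [fr fi]; apply/eqP; rewrite eq_complex ReM ImM /=.
rewrite -!RintegralZl//.
have iZ (h : T -> R) r : mu.-integrable setT (EFin \o h) ->
    mu.-integrable setT (EFin \o (fun x => r * h x)).
  exact: integrableZl.
rewrite -RintegralB ?iZ// -RintegralD ?iZ//.
apply/andP; split; apply/eqP; apply: eq_Rintegral => x _; [exact: ReM|].
exact: ImM.
Qed.

Lemma cintegrable_sum (I : Type) (s : seq I) (F : I -> T -> R[i]) :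
  (forall i, cintegrable (F i)) -> cintegrable (fun x => \sum_(i <- s) F i x).
Proof.
move=> Fi; elim: s => [|i s ih].
  by under eq_fun do rewrite big_nil; exact: cintegrable0.
by under eq_fun do rewrite big_cons; exact: cintegrableD.
Qed.

Lemma cintegral_sum (I : Type) (s : seq I) (F : I -> T -> R[i]) :
  (forall i, cintegrable (F i)) ->
  cintegral mu (fun x => \sum_(i <- s) F i x) =
  \sum_(i <- s) cintegral mu (F i).
Proof.
move=> Fi; elim: s => [|i s ih].
  by under eq_fun do rewrite big_nil; rewrite big_nil cintegral0.
under eq_fun do rewrite big_cons.
by rewrite big_cons cintegralD ?ih//; exact: cintegrable_sum.
Qed.

(** Serves for the exponential factor of the Fourier integrand, whose components are bounded by
    1. *)
Lemma cintegrable_mulr_unit f (u v : T -> R) :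
  measurable_fun setT u -> measurable_fun setT v ->
  (forall x, `|u x| <= 1) -> (forall x, `|v x| <= 1) ->
  cintegrable f -> cintegrable (fun x => f x * (u x +i* v x)%C).
Proof.
move=> mu_u mv u1 v1 [fr fi].
have bnd w : (forall x, `|w x| <= 1) -> [bounded w x : R^o | x in [set: T]].
  move=> w1; exists 1; split; first exact: num_real.
  by move=> M M1 x _ /=; rewrite (le_trans (w1 x))// ltW.
have mulb (h w : T -> R) : measurable_fun setT w -> (forall x, `|w x| <= 1) ->
    mu.-integrable setT (fun x => (h x)%:E) ->
    mu.-integrable setT (fun x => (h x * w x)%:E).
  move=> mw w1 hi; under eq_fun do rewrite EFinM.
  have := @integrableMl _ _ _ mu setT measurableT (fun x => (h x)%:E) w.
  by apply => //; exact: bnd.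
split.
  under eq_fun do rewrite ReM EFinB.
  by apply: integrableB => //; exact: mulb.
under eq_fun do rewrite ImM EFinD.
by apply: integrableD => //; exact: mulb.
Qed.

Lemma cintegrable_preserving h f : measure_preserving mu h ->
  cintegrable f -> cintegrable (f \o h).
Proof.
by move=> hP [fr fi]; split;
  [exact: (measure_preserving_integrable hP fr)|
   exact: (measure_preserving_integrable hP fi)].
Qed.

Lemma cintegral_preserving h f : measure_preserving mu h ->
  cintegrable f -> cintegral mu (f \o h) = cintegral mu f.
Proof.
move=> hP [fr fi]; rewrite /cintegral /Rintegral /=.
rewrite (measure_preserving_integral hP fr).
by rewrite (measure_preserving_integral hP fi).
Qed.

Lemma cintegral_ae0 f : cmeasurable f -> {ae mu, forall x, f x = 0} ->
  cintegral mu f = 0.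
Proof.
move=> [mfr mfi] f0; apply/eqP; rewrite eq_complex /=.
have int0 (h : T -> R) : measurable_fun setT h ->
    {ae mu, forall x, h x = 0} -> Rintegral mu setT h = 0.
  move=> mh h0; rewrite /Rintegral (ae_eq_integral (cst 0%E))//.
  - by rewrite integral0.
  - exact/measurable_EFinP.
  - by apply: filterS h0 => x hx0 _ /=; rewrite hx0.
by rewrite !int0 ?eqxx//; apply: filterS f0 => x ->.
Qed.

Lemma sqr_normc (z : R[i]) :
  Normc.normc z ^+ 2 = complex.Re z ^+ 2 + complex.Im z ^+ 2.
Proof. by case: z => a b /=; rewrite sqr_sqrtr// addr_ge0// sqr_ge0. Qed.

(** Each component [h] satisfies [|h| <= 1 + h ^+ 2] on [A] and vanishes almost everywhere off [A],
    so the indicator of [A] plus the squared modulus of [f] dominates it. *)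
Lemma squareIntegrable_cintegrable (A : set T) f :
  measurable A -> (mu A < +oo)%E -> {ae mu, forall x, ~ A x -> f x = 0} ->
  squareIntegrable mu f -> cintegrable f.
Proof.
move=> mA Aoo fA [[mfr mfi] foo].
have mw : measurable_fun setT (fun x => Normc.normc (f x) ^+ 2).
  under eq_fun do rewrite sqr_normc.
  by apply: measurable_funD; exact: measurable_funX.
have bound (h : T -> R) : measurable_fun setT h ->
    (forall x, h x ^+ 2 <= Normc.normc (f x) ^+ 2) ->
    mu.-integrable setT (fun x => (h x)%:E).
  move=> mh hf; apply/integrableP; split; first exact/measurable_EFinP.
  apply: (@le_lt_trans _ _
    (\int[mu]_x ((\1_A x)%:E + (Normc.normc (f x) ^+ 2)%:E))%E); last first.
    rewrite ge0_integralD//=.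
    - by rewrite integral_indic// setIT lte_add_pinfty.
    - exact/measurable_EFinP.
    - by move=> x _; rewrite lee_fin sqr_ge0.
    - exact/measurable_EFinP.
  apply: ae_ge0_le_integral => //.
  - by apply/measurable_EFinP; exact: measurableT_comp.
  - by move=> x _; rewrite -EFinD lee_fin addr_ge0// sqr_ge0.
  - by apply/measurable_EFinP; exact: measurable_funD.
  apply: filterS fA => x fA _; rewrite -EFinD lee_fin indicE.
  have [xA|/negP xA] := boolP (x \in A).
    rewrite (le_trans _ (lerD (lexx _) (hf x)))//=.
    rewrite -(@real_normK _ (h x)) ?num_real//.
    by have := sqr_ge0 (`|h x| - 1); nra.
  have fx0 : f x = 0 by apply: fA => /mem_set.
  have := hf x; rewrite fx0 Normc.normc0 expr0n/=.
  rewrite -(@real_normK _ (h x)) ?num_real//.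
  by rewrite add0r; have := sqr_ge0 `|h x|; nra.
split; apply: bound => // x; rewrite sqr_normc.
  by rewrite lerDl sqr_ge0.
by rewrite lerDr sqr_ge0.
Qed.

End ComplexIntegral.

(** * Fubini and null sets on vertical lines *)

Section Slices.
Context {R : realType}.
Local Notation mu := (@lebesgue_measure R).
Implicit Types (F : plane R -> R[i]).

Lemma cintegrable_slice F : cintegrable (leb2 R) F ->
  {ae leb1 R, forall t, cintegrable (leb1 R) (fun s => F (t, s))}.
Proof.
move=> [Fr Fi].
have := @ae_integrable1 _ _ _ _ R mu mu _ Fr.
have := @ae_integrable1 _ _ _ _ R mu mu _ Fi.
by apply: filterS2 => t.
Qed.

Lemma cintegral_slice0 F : cintegrable (leb2 R) F ->
  {ae leb1 R, forall t, cintegral (leb1 R) (fun s => F (t, s)) = 0} ->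
  cintegral (leb2 R) F = 0.
Proof.
move=> Fint F0; have Fslice := cintegrable_slice Fint; have [Fr Fi] := Fint.
(* Integrability is kept beside the vanishing because [fine] sends infinite integrals to 0 as
   well. *)
have part (h : plane R -> R) : (leb2 R).-integrable setT (EFin \o h) ->
    {ae leb1 R, forall t,
      (leb1 R).-integrable setT (fun s => (h (t, s))%:E) /\
      Rintegral (leb1 R) setT (fun s => h (t, s)) = 0} ->
    Rintegral (leb2 R) setT h = 0.
  move=> hi h0; rewrite /Rintegral.
  rewrite -[X in fine X](@integral12_prod_meas1 _ _ _ _ R mu mu _ hi).
  rewrite (ae_eq_integral (cst 0%E))//; first by rewrite integral0.
    exact: (@measurable_fubini_F _ _ _ _ R mu mu).
  apply: filterS h0 => t [ti t0] _; rewrite /fubini_F.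
  by rewrite -[LHS]fineK ?(integrable_fin_num _ ti)//; congr EFin.
apply/eqP; rewrite eq_complex /=.
apply/andP; split; apply/eqP; apply: part => //.
  by apply: filterS2 Fslice F0 => t [tr _] [].
by apply: filterS2 Fslice F0 => t [_ ti] [].
Qed.

(** The measures of the sections of a null set integrate to 0, so almost all of them are 0. *)
Lemma ae_slice (P : plane R -> Prop) : {ae leb2 R, forall x, P x} ->
  {ae leb1 R, forall t, {ae leb1 R, forall s, P (t, s)}}.
Proof.
move=> [N [mN N0 PN]].
have : ae_eq (leb1 R) setT (mu \o xsection N) (cst 0%E).
  apply/ae_eq_integral_abs => //; first exact: measurable_fun_xsection.
  rewrite -[RHS]N0 /leb2/= /product_measure1.
  by apply: eq_integral => t _ /=; rewrite gee0_abs.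
apply: filterS => t /(_ I) /= Nt; exists (xsection N t); split => //.
  exact: measurable_xsection.
by move=> s nP; rewrite /xsection /= inE; exact: PN.
Qed.

End Slices.

(** * The Radon transform of combinations of shifts *)

Section Radon.
Context {R : realType}.
Implicit Types (phi : plane R -> R[i]) (p : plane R).

Lemma ae_leb1S (P Q : R -> Prop) : (forall t, P t -> Q t) ->
  {ae leb1 R, forall t, P t} -> {ae leb1 R, forall t, Q t}.
Proof. exact: (@filterS _ _ (ae_filter_ringOfSetsType (leb1 R))). Qed.

Lemma ae_leb1S2 (P Q S : R -> Prop) : (forall t, P t -> Q t -> S t) ->
  {ae leb1 R, forall t, P t} -> {ae leb1 R, forall t, Q t} ->
  {ae leb1 R, forall t, S t}.
Proof. exact: (@filterS2 _ _ (ae_filter_ringOfSetsType (leb1 R))). Qed.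

Definition lattice (k : int * int) : plane R := (k.1%:~R, k.2%:~R).

(** In the orthonormal basis [p], [(- p.2, p.1)] the vector [lattice k] has coordinates
    [dot p (lattice k)] and [a]. The first changes the line of integration; the second slides along
    it and leaves the integral unchanged. *)
Lemma cintegrable_translate_slice phi p k t : dot p p = 1 ->
  cintegrable (leb1 R) (fun s => phi (rotate p (t - dot p (lattice k), s))) ->
  cintegrable (leb1 R) (fun s => translate k phi (rotate p (t, s))) /\
  radon p (translate k phi) t = radon p phi (t - dot p (lattice k)).
Proof.
move=> pp int_slice; pose a := p.1 * k.2%:~R - p.2 * k.1%:~R.
have shiftE : (fun s => translate k phi (rotate p (t, s))) =
    (fun s => phi (rotate p (t - dot p (lattice k), s))) \o (fun s => s - a).
  apply/funext => s /=; rewrite /translate /rotate /dot /lattice /a /=.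
  have e z : z = (p.1 * p.1 + p.2 * p.2) * z.
    by rewrite -[X in X * _]/(dot p p) pp mul1r.
  congr (phi (_, _)).
    by rewrite [X in _ - X = _]e; ring.
  by rewrite [X in _ - X = _]e; ring.
have ta := preserving_translation a.
split; first by rewrite shiftE; exact: cintegrable_preserving ta int_slice.
transitivity (cintegral (leb1 R)
  (fun s => translate k phi (rotate p (t, s)))) => //.
by rewrite shiftE; exact: cintegral_preserving ta int_slice.
Qed.

Lemma ae_mem {d} {T : measurableType d} (m : {measure set T -> \bar R})
    (K : eqType) (s : seq K) (P : K -> T -> Prop) :
  (forall k, k \in s -> {ae m, forall x, P k x}) ->
  {ae m, forall x, forall k, k \in s -> P k x}.
Proof.
elim: s => [|a s ih] Ps; first by apply: aeW => x k.
have Pa := Ps a (mem_head a s).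
have /ih : forall k, k \in s -> {ae m, forall x, P k x}.
  by move=> k ks; apply: Ps; rewrite inE ks orbT.
apply: filterS2 Pa => x Pax Psx k; rewrite inE => /predU1P[->//|].
exact: Psx.
Qed.

(** [c] is quantified inside the almost-everywhere statement: the null set comes from finitely many
    slices of [phi] and serves all coefficients. *)
Lemma radon_shift_comb (E : set (int * int)) phi p :
  finite_set E -> dot p p = 1 -> cintegrable (leb2 R) phi ->
  {ae leb1 R, forall t, forall c, radon p (shift_comb E c phi) t =
     \sum_(k <- fset_set E) c k * radon p phi (t - dot p (lattice k))}.
Proof.
move=> finE pp phi_int.
have rot_int : cintegrable (leb2 R) (phi \o rotate p).
  exact: cintegrable_preserving (preserving_rotation pp) phi_int.
have slices := cintegrable_slice rot_int.
have : {ae leb1 R, forall t, forall k, k \in (fset_set E : seq _) ->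
    cintegrable (leb1 R) (fun s => phi (rotate p (t - dot p (lattice k), s)))}.
  apply: ae_mem => k _.
  have ta := preserving_translation (dot p (lattice k)).
  exact: (measure_preserving_ae ta slices).
apply: ae_leb1S => t st c.
(* [cintegral_sum] asks for integrability at every index; the [if] supplies it outside [E]. *)
transitivity (cintegral (leb1 R) (fun s => \sum_(k <- fset_set E)
    c k * (if k \in fset_set E then translate k phi (rotate p (t, s)) else 0))).
  congr cintegral; apply/funext => s.
  rewrite /shift_comb fsbig_finite//=; apply: eq_big_seq => k kE.
  by rewrite kE.
rewrite cintegral_sum; last first.
  move=> k; apply: cintegrableZ.
  have [kE|_] := boolP (k \in fset_set E); last exact: cintegrable0.
  exact: (cintegrable_translate_slice pp (st _ kE)).1.
apply: eq_big_seq => k kE; rewrite kE.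
have [h1 h2] := cintegrable_translate_slice pp (st _ kE).
by rewrite cintegralZ// -h2.
Qed.

Lemma normr_le_endpoints (a b x : R) : a <= x -> x <= b -> `|x| <= `|a| + `|b|.
Proof.
move=> ax xb; rewrite ler_norml; apply/andP; split.
  rewrite (le_trans _ ax)// lerNl (le_trans (ler_norm _))// normrN lerDl.
  exact: normr_ge0.
by rewrite (le_trans xb)// (le_trans (ler_norm _))// lerDr normr_ge0.
Qed.

(** Every point of the line at offset [t] has inner product [t] with [p]. As [B] bounds both
    coordinates on the rectangle, a line meeting it has [|t| <= 2 * B]. *)
Lemma radon_bounded_support phi p (a b c d : R) : dot p p = 1 ->
  cmeasurable phi -> supported_in (rect a b c d) phi ->
  exists M, {ae leb1 R, forall t, M < `|t| -> radon p phi t = 0}.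
Proof.
move=> pp [mr mi] supp.
have rP := preserving_rotation pp; have [mrot _] := rP.
pose B : R := `|a| + `|b| + (`|c| + `|d|).
exists (2 * B).
have := ae_slice (measure_preserving_ae rP supp).
apply: filterS => t supp_t Mt.
apply: cintegral_ae0.
  have mt : measurable_fun setT (fun s : measurableTypeR R => rotate p (t, s)).
    exact: (measurableT_comp mrot (pair1_measurable t)).
  by split; [exact: (measurableT_comp mr mt)|exact: (measurableT_comp mi mt)].
apply: filterS supp_t => s; apply => -[] /=.
set x1 := _ - _; set x2 := _ + _ => /andP[ax xb] /andP[cx xd].
have unit_coord (u v : R) : u * u + v * v = 1 -> `|u| <= 1.
  move=> uv; rewrite -(@expr_le1 _ 2)// real_normK ?num_real// -uv expr2.
  by rewrite lerDl -expr2 sqr_ge0.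
have p1 : `|p.1| <= 1 by exact: unit_coord pp.
have p2 : `|p.2| <= 1 by apply: (@unit_coord _ p.1); rewrite addrC.
have tE : t = x1 * p.1 + x2 * p.2.
  rewrite -[LHS]mulr1 -pp /x1 /x2 /dot; ring.
have x1B : `|x1| <= B.
  by rewrite (le_trans (normr_le_endpoints ax xb))// /B lerDl addr_ge0.
have x2B : `|x2| <= B.
  by rewrite (le_trans (normr_le_endpoints cx xd))// /B lerDr addr_ge0.
suff : `|t| <= 2 * B by rewrite leNgt Mt.
rewrite tE (le_trans (ler_normD _ _))// !normrM mulr_natl mulr2n lerD//.
  by rewrite -[leRHS]mulr1 ler_pM.
by rewrite -[leRHS]mulr1 ler_pM.
Qed.

(** Fourier slice identity: at frequency [r] times [p] the exponential is constant on each line of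
    integration, so a slice integral is that constant times the Radon transform. *)
Lemma radon_neq0 phi p r : dot p p = 1 -> cintegrable (leb2 R) phi ->
  fourier phi (r * p.1, r * p.2) <> 0 ->
  ~ {ae leb1 R, forall t, radon p phi t = 0}.
Proof.
move=> pp phi_int four0 g0; apply: four0.
have rP := preserving_rotation pp.
pose u (x : plane R) := cos (dot x (r * p.1, r * p.2)).
pose v (x : plane R) := - sin (dot x (r * p.1, r * p.2)).
have mdot : measurable_fun setT (fun x : plane R => dot x (r * p.1, r * p.2)).
  rewrite /dot /=; apply: measurable_funD; apply: measurable_funM => //.
have F_int : cintegrable (leb2 R) (fun x => phi x * (u x +i* v x)%C).
  apply: cintegrable_mulr_unit => //.
  - apply: (measurableT_comp _ mdot); apply: continuous_measurable_fun.
    exact: continuous_cos.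
  - apply: measurableT_comp; first exact: oppr_measurable.
    apply: (measurableT_comp _ mdot); apply: continuous_measurable_fun.
    exact: continuous_sin.
  - by move=> x; rewrite ler_norml cos_geN1 cos_le1.
  - by move=> x; rewrite normrN ler_norml sin_geN1 sin_le1.
rewrite /fourier -(cintegral_preserving rP F_int).
apply: cintegral_slice0; first exact: cintegrable_preserving rP F_int.
have := cintegrable_slice (cintegrable_preserving rP phi_int).
apply: (ae_leb1S2 _ g0) => t gt0 slice_t.
transitivity (cintegral (leb1 R) (fun s =>
    (cos (r * t) -i* sin (r * t))%C * phi (rotate p (t, s)))).
  congr cintegral; apply/funext => s /=; rewrite mulrC /u /v.
  suff -> : dot (rotate p (t, s)) (r * p.1, r * p.2) = r * t by [].
  transitivity (r * t * dot p p); last by rewrite pp mulr1.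
  by rewrite /dot /rotate/=; ring.
by rewrite cintegralZ// -[X in _ * X]/(radon p phi t) gt0 mulr0.
Qed.

End Radon.

(** * Translates of a function of bounded support on the line *)

Section Translates.
Context {R : realType}.
Local Notation mu := (@lebesgue_measure R).
Implicit Types (f g h u : R -> R[i]).

(** Equals 1 up to [M] and 0 from [M + 1] on, with an affine ramp between, so that truncation
    preserves continuity. *)
Definition cutoff (M : R) (t : R) : R[i] :=
  (Num.min 1 (Num.max 0 (M + 1 - t)))%:C%C.

(* Used for the continuous functions and for the zero function alone. *)
Definition stable_class (Q : set (R -> R[i])) : Prop :=
  [/\ Q (fun=> 0),
      forall f g, Q f -> Q g -> Q (fun t => f t + g t),
      forall z f, Q f -> Q (fun t => z * f t),
      forall a f, Q f -> Q (fun t => f (t - a)) &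
      forall M f, Q f -> Q (fun t => cutoff M t * f t)].

Lemma stable_class0 : stable_class [set f | f = fun=> 0].
Proof.
split=> //=.
- by move=> f g -> ->; apply/funext => t; rewrite addr0.
- by move=> z f ->; apply/funext => t; rewrite mulr0.
- by move=> a f ->.
- by move=> M f ->; apply/funext => t; rewrite mulr0.
Qed.

Lemma continuous_real_complex :
  continuous ((fun x : R => x%:C%C) : R -> R[i]^o).
Proof.
move=> x; apply/cvgrPdist_lt => e e0.
(* A positive element of [R[i]] is real. *)
have [e1 e2] : complex.Im e = 0 /\ 0 < complex.Re e.
  by move: e0; rewrite ltcE /= => /andP[/eqP -> ->].
near=> y.
rewrite -rmorphB /= normc_def /= expr0n /= addr0 sqrtr_sqr.
rewrite (_ : e = (complex.Re e)%:C%C); last by case: (e) e1 => a b /= ->.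
rewrite ltcR.
near: y; exact: (@cvgr_dist_lt _ _ _ _ _ id x cvg_id _ e2).
Unshelve. all: by end_near. Qed.

Lemma stable_class_continuous :
  stable_class [set f | continuous (f : R -> R[i]^o)].
Proof.
split=> /=.
- by move=> t; exact: cvg_cst.
- by move=> f g cf cg t; apply: (@cvgD R[i] R[i]^o); [exact: cf|exact: cg].
- by move=> z f cf t; apply: (@cvgM R[i]); [exact: cvg_cst|exact: cf].
- move=> a f cf t.
  have ct : {for t, continuous (fun t : R => t - a)}.
    by apply: cvgB; [exact: cvg_id|exact: cvg_cst].
  exact: (continuous_comp ct (cf (t - a))).
- move=> M f cf t; apply: (@cvgM R[i]); last exact: cf.
  have ct : {for t, continuous
      (fun t : R => Num.min 1 (Num.max 0 (M + 1 - t)))}.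
    apply: (@continuous_min R R (cst 1)); first exact: cvg_cst.
    apply: (@continuous_max R R (cst 0)); first exact: cvg_cst.
    by apply: cvgB; [exact: cvg_cst|exact: cvg_id].
  exact: (continuous_comp ct (@continuous_real_complex _)).
Qed.

(** A nonzero value would persist on a ball, which has positive measure. *)
Lemma continuous_ae0 u : continuous (u : R -> R[i]^o) ->
  {ae leb1 R, forall t, u t = 0} -> forall t, u t = 0.
Proof.
move=> cu [N [mN N0 uN]] t; apply: contrapT => ut.
have : \forall x \near t, u x != 0.
  have u0 : u t != 0 by exact/eqP.
  exact: (@cvgr_neq0 _ R[i]^o _ _ _ _ _ (cu t) u0).
move=> /nbhs_ballP[e /= e0 tN].
have : (mu (ball t e) <= mu N)%E.
  rewrite le_measure ?inE//; first exact: measurable_ball.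
  by move=> x /tN /eqP; exact: uN.
rewrite lebesgue_measure_ball; last exact: ltW.
rewrite leNgt => /negP; apply.
by apply: (@le_lt_trans _ _ 0%E); [rewrite -N0|rewrite lte_fin mulr2n addr_gt0].
Qed.

Lemma min_gap (K : eqType) (s : seq K) (tau : K -> R) :
  {in s &, injective tau} -> s != [::] ->
  exists k0 delta, [/\ k0 \in s, 0 < delta &
    forall k, k \in s -> k != k0 -> tau k0 + delta <= tau k].
Proof.
elim: s => // a s ih inj _.
have [->|/ih] := eqVneq s [::].
  (* With a single element the gap condition is vacuous, and 1 is an arbitrary positive gap. *)
  by exists a, 1; rewrite mem_head; split=> // k; rewrite inE => ->.
have injs : {in s &, injective tau}.
  by move=> x y xs ys; apply: inj; rewrite inE ?xs ?ys orbT.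
move=> /(_ injs)[k0 [e [k0s e0 gap]]].
have [ka|ka] := eqVneq k0 a.
  exists k0, e; split=> //; first by rewrite inE k0s orbT.
  by move=> k; rewrite inE => /predU1P[->|]; [rewrite ka eqxx|exact: gap].
have : tau a != tau k0.
  apply: contra ka => /eqP eq; apply/eqP/esym/inj => //; first exact: mem_head.
  by rewrite inE k0s orbT.
rewrite neq_lt => /orP[lt|lt].
  exists a, (tau k0 - tau a); split; [exact: mem_head|by rewrite subr_gt0|].
  move=> k; rewrite inE => /predU1P[->|ks]; first by rewrite eqxx.
  have [-> _|kk0 _] := eqVneq k k0; first by lra.
  by have := gap _ ks kk0; lra.
exists k0, (Num.min e (tau a - tau k0)); split.
- by rewrite inE k0s orbT.
- by rewrite lt_min e0 subr_gt0.
- move=> k; rewrite inE => /predU1P[->|ks] kk0.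
    by rewrite -lerBrDl ge_min lexx orbT.
  by rewrite -lerBrDl ge_min lerBrDl gap.
Qed.

(** With [Q] the zero function alone this gives independence of the translates; with [Q] the
    continuous functions it passes a continuous representative from a combination to [g]. *)
Lemma translates_representative (Q : set (R -> R[i])) (K : eqType) (s : seq K)
    (tau : K -> R) (c : K -> R[i]) g h M :
  stable_class Q -> uniq s -> {in s &, injective tau} ->
  (exists2 k, k \in s & c k != 0) ->
  {ae leb1 R, forall t, M < `|t| -> g t = 0} ->
  Q h -> {ae leb1 R, forall t, \sum_(k <- s) c k * g (t - tau k) = h t} ->
  exists2 g', Q g' & {ae leb1 R, forall t, g t = g' t}.
Proof.
move=> [Q0 QD QZ Qtr Qcut] us inj [k1 k1s ck1] gM Qh gh.
(* Only nonzero coefficients compete for the least [tau], since solving for that term divides by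
   [c k0]. *)
have inj0 : {in [seq k <- s | c k != 0] &, injective tau}.
  by move=> x y; rewrite !mem_filter => /andP[_ xs] /andP[_ ys]; exact: inj.
have ne0 : [seq k <- s | c k != 0] != [::].
  by rewrite -has_filter; apply/hasP; exists k1.
have [k0 [e [k0s e0 gap]]] := min_gap inj0 ne0.
move: k0s; rewrite mem_filter => /andP[ck0 k0s].
(* [g] is a fixed point of [T] almost everywhere, and [T f t] depends only on
   the values of [f] up to [t - e]; so the iterates [G n] of [T] from [0] agree
   with [g] on larger and larger half lines. *)
pose T f t := (c k0)^-1 * (h (t - - tau k0) +
  \sum_(k <- rem k0 s) (- c k) * f (t - (tau k - tau k0))).
have Tg : {ae leb1 R, forall t, g t = T g t}.
  have := measure_preserving_ae (preserving_translation (- tau k0)) gh.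
  apply: ae_leb1S => t.
  rewrite (big_rem k0)//= opprK addrK => E.
  apply: (mulfI ck0); rewrite mulrA divff// mul1r opprK -E.
  rewrite -[LHS]addr0 -addrA; congr (_ + _).
  rewrite -big_split /= big1_seq// => k _.
  by rewrite mulNr opprB addrA subrr.
pose G n := iter n T (fun=> 0).
have QG n : Q (G n).
  elim: n => [|n ih]; first exact: Q0.
  apply/QZ/QD; first exact: Qtr.
  elim: (rem k0 s) => [|k r ihr]; first by under eq_fun do rewrite big_nil.
  under eq_fun do rewrite big_cons.
  by apply/QD => //; apply/QZ; exact: Qtr.
have Gg n : {ae leb1 R, forall t, t < - M + n%:R * e -> g t = G n t}.
  elim: n => [|n ih].
    (* Left of [- M] the support bound makes [g] zero, like the starting iterate. *)
    apply: (ae_leb1S _ gM) => t gt tM.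
    by apply: gt; have := lerNnormlW (lexx `|t|); lra.
  have : {ae leb1 R, forall t, forall k, k \in rem k0 s ->
      t - (tau k - tau k0) < - M + n%:R * e ->
      g (t - (tau k - tau k0)) = G n (t - (tau k - tau k0))}.
    apply: ae_mem => k _.
    exact: (measure_preserving_ae (preserving_translation (tau k - tau k0)) ih).
  apply: (ae_leb1S2 _ Tg) => t -> gG tM.
  rewrite /G iterS -/(G n) /T; congr (_ * (_ + _)).
  apply: eq_big_seq => k kr.
  move: (kr); rewrite mem_rem_uniq// inE => /andP[kk0 ks].
  (* The gap is not known for indices with zero coefficient, but their terms vanish. *)
  have [->|ck] := eqVneq (c k) 0; first by rewrite oppr0 !mul0r.
  congr (_ * _); apply: gG => //.
  have : tau k0 + e <= tau k by apply: gap => //; rewrite mem_filter ck.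
  by move: tM; rewrite -natr1 mulrDl mul1r; lra.
(* Enough iterations for the agreement to reach [M + 1], the end of the ramp; the absolute value
   allows a negative [M]. *)
pose n := Num.bound ((2 * `|M| + 1) / e).
have nM : M + 1 <= - M + n%:R * e.
  have : (2 * `|M| + 1) / e < n%:R.
    by apply: archi_boundP; rewrite divr_ge0 ?(ltW e0)// addr_ge0// mulr_ge0.
  by rewrite ltr_pdivrMr//; have := ler_norm M; lra.
exists (fun t => cutoff M t * G n t); first exact: Qcut.
apply: (ae_leb1S2 _ gM (Gg n)) => t gt Gt.
(* Up to [M] the cutoff is 1; on the ramp [g] and the iterate are both 0; beyond it the cutoff is
   0. *)
have [tM|tM] := leP t M.
  rewrite /cutoff max_r; last by lra.
  by rewrite min_l ?mul1r; [apply: Gt|]; lra.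
have g0 : g t = 0 by apply: gt; rewrite (lt_le_trans tM)// ler_norm.
have [tM1|tM1] := ltP t (M + 1).
  by rewrite -Gt ?g0 ?mulr0//; lra.
by rewrite g0 /cutoff max_l ?min_r// ?mul0r//; lra.
Qed.

End Translates.

(** * Separating independent functions by points *)

(** Points are added one at a time, keeping the rows of values independent. They are distinct
    because a repeated point would repeat a row of a free matrix. *)
Lemma independent_sample_points (F : fieldType) (T : Type) (n : nat)
    (v : 'I_n -> T -> F) (G : set T) :
  (forall c : 'I_n -> F, (forall t, G t -> \sum_i c i * v i t = 0) ->
    forall i, c i = 0) ->
  exists x : 'I_n -> T, [/\ forall i, G (x i), injective x &
    forall c : 'I_n -> F, (forall j, \sum_i c i * v i (x j) = 0) ->
      forall i, c i = 0].
Proof.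
move=> indep.
pose A m (x : 'I_m -> T) := \matrix_(j, i) v i (x j) : 'M[F]_(m, n).
have free_points m : (m <= n)%N ->
    exists x : 'I_m -> T, (forall i, G (x i)) /\ row_free (A m x).
  elim: m => [_|m ih mn].
    exists (fun i : 'I_0 => False_rect T (notF (ltn_ord i))).
    by split=> [[]|]//; rewrite /row_free flatmx0 mxrank0.
  have [x [Gx xfree]] := ih (ltnW mn).
  have [t Gt tA] : exists2 t, G t & ~~ (\row_i v i t <= A m x)%MS.
    (* If every row over [G] lay in the row space, each column of the cokernel would give a
       combination vanishing on [G], hence be 0; but [m < n] makes the cokernel nonzero. *)
    apply: contrapT => nt.
    have : cokermx (A m x) != 0.
      by rewrite -mxrank_eq0 mxrank_coker -lt0n subn_gt0 (eqP xfree).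
    move=> /eqP; apply; apply/matrixP => i j; rewrite [RHS]mxE.
    apply: (indep (fun i => cokermx (A m x) i j)) => t Gt.
    have : (\row_i v i t <= A m x)%MS.
      by apply: contrapT => /negP tA; apply: nt; exists t.
    rewrite submxE => /eqP/matrixP/(_ 0 j); rewrite !mxE => vt.
    rewrite -[RHS]vt.
    by apply: eq_bigr => k _; rewrite !mxE mulrC.
  pose x' (k : 'I_m.+1) := if unlift ord0 k is Some k' then x k' else t.
  exists x'; split.
    by move=> k; rewrite /x'; case: unliftP.
  have rowA' k : (\row_i v i (x' k) <= A m.+1 x')%MS.
    rewrite (_ : \row_i _ = row k (A m.+1 x')) ?row_sub//.
    by apply/rowP => i; rewrite !mxE.
  have : (A m x < A m.+1 x')%MS.
    apply/andP; split.
      apply/row_subP => k.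
      rewrite (_ : row k _ = \row_i v i (x' (lift ord0 k))) ?rowA'//.
      by apply/rowP => i; rewrite !mxE /x' liftK.
    apply: contra tA; apply: submx_trans.
    by have := rowA' ord0; rewrite /x' unlift_none.
  rewrite ltmxErank => /andP[_]; rewrite (eqP xfree) => rk.
  by rewrite /row_free eqn_leq rank_leq_row.
have [x [Gx xfree]] := free_points n (leqnn n).
exists x; split=> //.
  move=> i j xij.
  have /(row_free_inj xfree) :
      delta_mx (0 : 'I_1) i *m A n x = delta_mx 0 j *m A n x.
    by rewrite -!rowE; apply/rowP => k; rewrite !mxE xij.
  move=> /rowP/(_ i); rewrite !mxE !eqxx /=.
  by case: eqVneq => // _ /eqP; rewrite oner_eq0.
move=> c c0 i.
have Ac : A n x *m (\col_k c k) = 0.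
  apply/colP => j; rewrite !mxE -[RHS](c0 j); apply: eq_bigr => k _.
  by rewrite !mxE mulrC.
have : \col_k c k = 0.
  have unitA : A n x \in unitmx by rewrite -row_free_unit.
  by rewrite -(mulKmx unitA (\col_k c k)) Ac mulmx0.
by move=> /colP/(_ i); rewrite !mxE.
Qed.

(** * Sampled values, the index set and admissible directions *)

Section Samples.
Context {R : realType}.
Implicit Types (phi : plane R -> R[i]) (p : plane R).

(** [xget] chooses a representative for each combination separately; the two cases of the proof show
    that the choices are linear in [c] off one common null set. *)
Lemma radon_sample_shift_comb (E : set (int * int)) phi p (M : R) :
  finite_set E -> dot p p = 1 -> cintegrable (leb2 R) phi ->
  {in fset_set E &, injective (fun k => dot p (lattice k))} ->
  {ae leb1 R, forall t, M < `|t| -> radon p phi t = 0} ->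
  {ae leb1 R, forall t, forall c, radon_sample p (shift_comb E c phi) t =
     \sum_(k <- fset_set E) c k * radon p phi (t - dot p (lattice k))}.
Proof.
move=> finE pp phi_int inj supp.
have combE := radon_shift_comb finE pp phi_int.
pose tau k := dot p (lattice k).
have [[g' cg' gg']|nocont] := pselect (exists2 g' : R -> R[i],
    continuous (g' : R -> R[i]^o) &
    {ae leb1 R, forall t, radon p phi t = g' t}).
  have gtau : {ae leb1 R, forall t, forall k, k \in (fset_set E : seq _) ->
      radon p phi (t - tau k) = g' (t - tau k)}.
    apply: ae_mem => k _.
    exact: (measure_preserving_ae (preserving_translation (tau k)) gg').
  have [C0 CD CZ Ctr _] := @stable_class_continuous R.
  have cw (c : int * int -> R[i]) : continuous
      ((fun t => \sum_(k <- fset_set E) c k * g' (t - tau k)) : R -> R[i]^o).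
    elim: (fset_set E : seq _) => [|k s ih].
      by under eq_fun do rewrite big_nil; exact: C0.
    under eq_fun do rewrite big_cons.
    by apply: (CD _ _ _ ih); apply: CZ; exact: Ctr.
  have radonE c : {ae leb1 R, forall t, radon p (shift_comb E c phi) t =
      \sum_(k <- fset_set E) c k * g' (t - tau k)}.
    apply: (ae_leb1S2 _ combE gtau) => t -> gt.
    by apply: eq_big_seq => k kE; rewrite gt.
  (* Two continuous representatives differ by a continuous function that is 0 almost everywhere, so
     the choice is forced. *)
  have sampleE c : radon_sample p (shift_comb E c phi) =
      fun t => \sum_(k <- fset_set E) c k * g' (t - tau k).
    apply: xget_unique => [|w [cw' ww]].
      by split; [exact: cw|exact: radonE].
    apply/funext => t; apply/eqP; rewrite -subr_eq0; apply/eqP; move: t.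
    apply: continuous_ae0.
      rewrite (_ : (fun t => _) = fun t => w t +
          -1 * \sum_(k <- fset_set E) c k * g' (t - tau k)).
        exact: CD cw' (CZ (-1) _ (cw c)).
      by apply/funext => t; rewrite mulN1r.
    by apply: (ae_leb1S2 _ ww (radonE c)) => t <- ->; rewrite subrr.
  apply: (ae_leb1S _ gtau) => t gt c.
  by rewrite sampleE; apply: eq_big_seq => k kE; rewrite gt.
apply: (ae_leb1S _ combE) => t radonE c.
rewrite /radon_sample; case: xgetP => [w _ [cw ww]|_]; last exact: radonE.
have wE : {ae leb1 R, forall t,
    \sum_(k <- fset_set E) c k * radon p phi (t - tau k) = w t}.
  by apply: (ae_leb1S2 _ combE ww) => u <- ->.
(* A nonzero coefficient would contradict [nocont]; so the combination is trivial and both sides are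
   0. *)
have c0 k : k \in (fset_set E : seq _) -> c k = 0.
  move=> kE; apply/eqP; apply: contrapT => /negP ck; apply: nocont.
  have some_c : exists2 k, k \in (fset_set E : seq _) & c k != 0 by exists k.
  exact: (translates_representative stable_class_continuous (fset_uniq _) inj
    some_c supp cw wE).
have sum0 u : \sum_(k <- fset_set E) c k * radon p phi (u - tau k) = 0.
  by rewrite big1_seq// => k /andP[_ kE]; rewrite c0// mul0r.
rewrite sum0; apply: continuous_ae0 => //.
by apply: (ae_leb1S _ wE) => u; rewrite sum0 => ->.
Qed.

Lemma finite_index_set (N1 M1 N2 M2 a1 b1 a2 b2 : R) :
  finite_set (index_set N1 M1 N2 M2 a1 b1 a2 b2).
Proof.
have fin_int (l u : int) : finite_set [set z : int | l <= z <= u].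
  apply: (@sub_finite_set _ _ ((fun n : nat => l + n%:Z) @` `I_(`|u - l|.+1))).
    move=> z /= /andP[lz zu]; exists `|z - l|%N.
      by rewrite /= ltnS; lia.
    by lia.
  exact/finite_image/finite_II.
apply: sub_finite_set (finite_setX (fin_int _ _) (fin_int _ _)).
by move=> [k l] [/= h1 h2]; split; [exact: h1|exact: h2].
Qed.

(** By the definition of the supremum, a point at distance less than [delta_max] lies in one of the
    zero-free discs; it is its norm times [p]. *)
Lemma DV_direction (F : plane R -> R[i]) p : DV F p ->
  (exists theta, p = (cos theta, sin theta)) /\
  exists r, F (r * p.1, r * p.2) <> 0.
Proof.
move=> [x Fx [y [th [ydisc y0 yE ->]]]]; split; first by exists th.
exists (norm2 y); rewrite /= -yE.
move: ydisc => /ereal_sup_gt[d [d0 nz]] yd.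
exact: nz.
Qed.

(** Equal inner products make [p] orthogonal to a difference, so [p] is in the null set and, being a
    unit vector, is its own direction. *)
Lemma dot_lattice_inj (E : set (int * int)) (theta : R) :
  ~ dv (orth_null_set (differences E)) (cos theta, sin theta) ->
  {in E &, injective (fun k => dot (cos theta, sin theta) (lattice k))}.
Proof.
set p := (cos theta, sin theta) => ndv k l /set_mem Ek /set_mem El eqkl.
apply: contrapT => kl; apply: ndv.
have n1 : norm2 p = 1 by rewrite /norm2 /= cos2Dsin2 sqrtr1.
have p0 : p <> (0, 0).
  move=> [c0 s0]; have := @cos2Dsin2 R theta.
  by rewrite c0 s0 expr0n/= addr0 => /eqP; rewrite eq_sym oner_eq0.
exists p, theta; split; rewrite ?n1 ?mul1r//; split=> //.
exists ((k.1 - l.1)%:~R, (k.2 - l.2)%:~R); split.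
- by exists k, l.
- move=> [] /eqP; rewrite intr_eq0 subr_eq0 => /eqP e1 /eqP.
  rewrite intr_eq0 subr_eq0 => /eqP e2; apply: kl.
  by case: (k) (l) e1 e2 => ? ? [? ?] /= -> ->.
- move: eqkl; rewrite /dot /lattice /= => /eqP; rewrite -subr_eq0 => /eqP <-.
  by rewrite !rmorphB /=; ring.
Qed.

End Samples.

(** * Choice of the sampling set and unique determination *)

Theorem theorem4p5 (R : realType) (phi : plane R -> R[i])
    (N1 M1 N2 M2 a1 b1 a2 b2 : R) :
  squareIntegrable (leb2 R) phi ->
  supported_in (rect N1 M1 N2 M2) phi ->
  shifts_independent phi ->
  ((2^-1)%:E < sobolev_exponent phi)%E ->
  fourier phi (0, 0) = 0 ->
  let E := index_set N1 M1 N2 M2 a1 b1 a2 b2 in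
  forall p : plane R, (DV (fourier phi) `\` dv (orth_null_set (differences E))) p ->
  exists X : set R, (X #= E)%card /\
    forall f : plane R -> R[i],
      target_function N1 M1 N2 M2 a1 b1 a2 b2 phi f ->
      determined_by_radon_samples E phi p X f.
Proof.
move=> phi_L2 supp _ _ _ E p [/DV_direction[[theta pE] [r four_neq0]] ndv].
have pp : dot p p = 1 by rewrite pE /dot /= -!expr2 cos2Dsin2.
have finE : finite_set E by exact: finite_index_set.
pose s : seq (int * int) := fset_set E; pose tau k := dot p (lattice k).
have inE_s k : (k \in s) = (k \in E) by rewrite in_fset_set.
have inj : {in s &, injective tau}.
  by move=> k l; rewrite !inE_s /tau pE; apply: dot_lattice_inj; rewrite -pE.
have rectE : rect N1 M1 N2 M2 = `[N1, M1] `*` `[N2, M2].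
  by apply/seteqP; split=> x [] /=; rewrite !in_itv/=.
have mrect : measurable (rect N1 M1 N2 M2) by rewrite rectE; exact: measurableX.
have rect_oo : (leb2 R (rect N1 M1 N2 M2) < +oo)%E.
  rewrite rectE /leb2/= product_measure1E//.
  have := @lebesgue_measure_itv R `[N1, M1].
  have := @lebesgue_measure_itv R `[N2, M2].
  rewrite /= => -> ->.
  by case: ifP => _; case: ifP => _; rewrite -?EFinB ?mule0 ?mul0e -?EFinM ltry.
have phi_int := squareIntegrable_cintegrable mrect rect_oo supp phi_L2.
have [M gM] := radon_bounded_support pp phi_L2.1 supp.
have samples := radon_sample_shift_comb finE pp phi_int inj gM.
pose v i t := radon p phi (t - tau (nth (0, 0) s i)).
(* [G] has full measure by [samples]; at points drawn from it all samples are linear in the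
   coefficients. *)
pose G := [set t | forall c, radon_sample p (shift_comb E c phi) t =
  \sum_(k <- s) c k * radon p phi (t - tau k)].
have us : uniq s by exact: fset_uniq.
(* Carries coefficients from positions in [s] to lattice points; as [s] is duplicate-free, a listed
   point receives one term. *)
pose ext (c : 'I_(size s) -> R[i]) k :=
  \sum_(i < size s | nth (0, 0) s i == k) c i.
have extE c (i : 'I_(size s)) : ext c (nth (0, 0) s i) = c i.
  rewrite /ext (big_pred1 i)// => j.
  by rewrite nth_uniq.
have sumE (F : int * int -> R[i]) :
    \sum_(k <- s) F k = \sum_(i < size s) F (nth (0, 0) s i).
  by rewrite (big_nth (0, 0)) big_mkord.
have [|x [Gx xinj xdet]] :=
    @independent_sample_points _ _ (size s) (fun i => v i) G.
  (* Vanishing on [G] is vanishing almost everywhere, so a nonzero coefficient would force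
     [radon p phi] to be 0 almost everywhere. *)
  move=> c c0 i; apply/eqP; apply: contrapT => /negP ci.
  apply: (radon_neq0 pp phi_int four_neq0).
  have some_ext : exists2 k, k \in s & ext c k != 0.
    by exists (nth (0, 0) s i); rewrite ?mem_nth ?extE.
  have comb0 : {ae leb1 R, forall t,
      \sum_(k <- s) ext c k * radon p phi (t - tau k) = (fun=> 0) t}.
    apply: (ae_leb1S _ samples) => t Gt.
    rewrite sumE -[RHS](c0 t Gt); apply: eq_bigr => j _.
    by rewrite extE.
  have [g' -> //] := translates_representative (@stable_class0 R) us inj
    some_ext gM erefl comb0.
(* Indexing the points by [E] makes the sampling set an injective image of [E]; the default 0 is
   taken only off [s]. *)
pose pt k := if insub (index k s) is Some i then x i else 0.
have ptE (i : 'I_(size s)) : pt (nth (0, 0) s i) = x i.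
  by rewrite /pt index_uniq// valK.
exists (pt @` E); split.
  apply: inj_card_eq => k l; rewrite -!inE_s => ks ls.
  rewrite -(nth_index (0, 0) ks) -(nth_index (0, 0) ls).
  have ki : (index k s < size s)%N by rewrite index_mem.
  have li : (index l s < size s)%N by rewrite index_mem.
  by rewrite (ptE (Ordinal ki)) (ptE (Ordinal li)) => /xinj [->].
move=> f [_ _ [c ->]] h [d ->] eq_samples.
(* The points lie in [G], so equal samples say that the coefficient differences give a combination
   vanishing at every point, and [xdet] applies. *)
have dc (i : 'I_(size s)) : d (nth (0, 0) s i) - c (nth (0, 0) s i) = 0.
  apply: (xdet (fun i : 'I_(size s) =>
    d (nth (0, 0) s i) - c (nth (0, 0) s i))) => j.
  have jE : E (nth (0, 0) s j) by apply/set_mem; rewrite -inE_s mem_nth.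
  have ptj : (pt @` E) (x j) by exists (nth (0, 0) s j) => //; exact: ptE.
  have := eq_samples _ ptj; rewrite !Gx !sumE => dc.
  under eq_bigr do rewrite mulrBl.
  by apply/eqP; rewrite sumrB subr_eq0; apply/eqP.
apply/funext => y; rewrite /shift_comb !fsbig_finite//= -/s !sumE.
apply: eq_bigr => i _; congr (_ * _); apply/eqP; rewrite -subr_eq0; apply/eqP.
exact: dc.
Qed.
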